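(* Let $\Gamma$ be a rational graph of degree $m=-Z^2\ge 3$. Then its complexity $\sum_{v}(\mathrm{val}(v)-2)$, the sum over all vertices $v$ of valency $\mathrm{val}(v)\ge 3$, is at most $m-2$.
   Context: A rational graph is a finite tree with vertices $E_i$ weighted by integers $-b_i\le -2$, such that the symmetric matrix with diagonal entries $E_i\cdot E_i=-b_i$ and off-diagonal entries $E_i\cdot E_j=1$ if adjacent and $0$ otherwise is negative definite, and such that the fundamental cycle $Z$ (smallest nonzero integer cycle with $Z\cdot E_i\le0$ for all $i$) satisfies $p_a(Z)=0$, where $p_a(A)=1+\tfrac12(A\cdot A+\sum a_i(b_i-2))$ for $A=\sum a_iE_i$. The degree is $-Z^2$; for a rational graph $-Z^2-2=\sum z_i(b_i-2)$ where $Z=\sum z_iE_i$. Valency means the number of neighbours in the tree. *)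

(* Defs.v *)
From HB Require Import structures.
From mathcomp Require Import all_boot all_order all_algebra.
Set Implicit Arguments. Unset Strict Implicit. Unset Printing Implicit Defensive.
Import Order.TTheory GRing.Theory Num.Theory.

(* A weighted graph on vertices E_i, i : 'I_n, with adjacency e and weights b i
   (vertex E_i has self-intersection -b i). *)

Definition is_tree (n : nat) (e : rel 'I_n) : Prop :=
  [/\ 0 < n,
      (forall i j, e i j = e j i),
      (forall i, ~~ e i i),
      (forall i j, connect e i j)
    & #|[set p : 'I_n * 'I_n | e p.1 p.2]| = 2 * n.-1]%N.

Definition inter_mx (n : nat) (e : rel 'I_n) (b : 'I_n -> nat) (i j : 'I_n) : int :=
  (if i == j then - (b i)%:Z else if e i j then 1 else 0)%R.

Definition inter (R : pzRingType) (n : nat) (e : rel 'I_n) (b : 'I_n -> nat)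
  (x y : 'I_n -> R) : R :=
  (\sum_(i < n) \sum_(j < n) x i * y j * (inter_mx e b i j)%:~R)%R.

Definition neg_definite (n : nat) (e : rel 'I_n) (b : 'I_n -> nat) : Prop :=
  forall x : 'I_n -> rat, (exists i, x i != 0%R) -> (inter e b x x < 0)%R.

Definition anti_nef (n : nat) (e : rel 'I_n) (b : 'I_n -> nat) (A : 'I_n -> int) :=
  forall i, (inter e b A (fun j => if j == i then 1%R else 0%R) <= 0)%R.

Definition fundamental_cycle (n : nat) (e : rel 'I_n) (b : 'I_n -> nat)
  (Z : 'I_n -> int) : Prop :=
  [/\ exists i, Z i != 0%R,
      anti_nef e b Z
    & forall A : 'I_n -> int, (exists i, A i != 0%R) -> anti_nef e b A ->
        forall i, (Z i <= A i)%R].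

Definition arith_genus (n : nat) (e : rel 'I_n) (b : 'I_n -> nat) (A : 'I_n -> int) : rat :=
  (1 + ((inter e b A A + \sum_(i < n) A i * ((b i)%:Z - 2))%:~R) / 2)%R.

Definition rational_graph (n : nat) (e : rel 'I_n) (b : 'I_n -> nat) (Z : 'I_n -> int) : Prop :=
  [/\ is_tree e,
      (forall i, 2 <= b i)%N,
      neg_definite e b,
      fundamental_cycle e b Z
    & arith_genus e b Z = 0%R].

Definition valency (n : nat) (e : rel 'I_n) (i : 'I_n) : nat := #|[set j | e i j]|.

Definition complexity (n : nat) (e : rel 'I_n) : nat :=
  (\sum_(i < n | 3 <= valency e i) (valency e i - 2))%N.

(* Main.v *)
Require Import Defs.
From HB Require Import structures.
From mathcomp Require Import all_boot all_order all_algebra.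
From mathcomp Require Import zify ring lra.
Import Order.TTheory GRing.Theory Num.Theory.

Set Implicit Arguments.
Unset Strict Implicit.
Unset Printing Implicit Defensive.

(** Since [p_a(Z) = 0], the claim is that the complexity is at most
    [\sum_i z_i (b_i - 2)].  Write [D] for the sum of all [E_i].  Along a
    computation sequence from [D] to [Z] the arithmetic genus cannot decrease,
    and [p_a(D) = p_a(Z) = 0], so every step [A -> A + E_i] has [A . E_i = 1].
    In particular [val_i <= b_i + 1], and the only vertices whose term
    [val_i - 2] is not covered by [z_i (b_i - 2)] are the bad ones, with
    [b_i = 2] and [val_i = 3].

    Starting at [D], add once each vertex with [b = 2] and [val >= 2] that the
    computation sequence can reach; the resulting set [S] contains every bad
    vertex together with its component among such vertices.  Two bad vertices
    never share a component, and as [m >= 3] each of these components is adjacent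
    to some [u] with [b_u >= 3].  If [u] has [t_u] neighbours in [S], then
    [val_u + t_u <= b_u + 1], with [z_u >= 2] in case of equality; hence
    [z_u (b_u - 2)] pays for [val_u - 2] and for [t_u] bad vertices. *)

(** * Intersection numbers and adjunction *)

Section IntersectionForm.

Variables (n : nat) (e : rel 'I_n) (b : 'I_n -> nat).
Hypothesis e_sym : forall i j, e i j = e j i.
Hypothesis e_irr : forall i, ~~ e i i.

Local Open Scope ring_scope.

Local Notation M := (inter_mx e b).

Definition dot (A : 'I_n -> int) (i : 'I_n) : int := \sum_(j < n) A j * M j i.

Lemma inter_mx_sym i j : M i j = M j i.
Proof. by rewrite /inter_mx eq_sym e_sym; case: eqP => [->|]. Qed.

Lemma interE (A B : 'I_n -> int) : inter e b A B = \sum_(i < n) B i * dot A i.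
Proof.
rewrite /inter exchange_big; apply: eq_bigr => i _; rewrite /dot mulr_sumr.
by apply: eq_bigr => j _; rewrite intz; ring.
Qed.

Lemma inter_delta (A : 'I_n -> int) i :
  inter e b A (fun j => if j == i then 1 else 0) = dot A i.
Proof.
rewrite interE (bigD1 i) //= eqxx mul1r big1 ?addr0 // => j /negPf ->.
by rewrite mul0r.
Qed.

Lemma inter_intr (A B : 'I_n -> int) :
  inter e b (fun i => (A i)%:~R : rat) (fun i => (B i)%:~R) = (inter e b A B)%:~R.
Proof.
rewrite /inter rmorph_sum; apply: eq_bigr => i _; rewrite rmorph_sum.
by apply: eq_bigr => j _; rewrite intz !rmorphM.
Qed.

Lemma dotE (A : 'I_n -> int) i : dot A i = \sum_(j < n | e i j) A j - A i * (b i)%:Z.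
Proof.
rewrite /dot (bigD1 i) //= [RHS]addrC; congr (_ + _).
  by rewrite /inter_mx eqxx mulrN.
rewrite big_mkcond [RHS]big_mkcond; apply: eq_bigr => j _ /=.
rewrite /inter_mx (e_sym j); have [->|_] := eqVneq j i.
  by rewrite (negPf (e_irr i)).
by case: (e i j); rewrite ?mulr1 ?mulr0.
Qed.

Lemma eq_dot (A B : 'I_n -> int) : A =1 B -> dot A =1 dot B.
Proof. by move=> AB i; apply: eq_bigr => j _; rewrite AB. Qed.

Definition add_vertex (A : 'I_n -> int) (i : 'I_n) : 'I_n -> int :=
  fun j => A j + (j == i)%:Z.

Lemma sum_add_vertex (A F : 'I_n -> int) i :
  \sum_(j < n) add_vertex A i j * F j = \sum_(j < n) A j * F j + F i.
Proof.
rewrite (eq_bigr (fun j => A j * F j + (j == i)%:Z * F j)); last first.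
  by move=> j _; rewrite mulrDl.
rewrite big_split /=; congr (_ + _).
rewrite (bigD1 i) //= eqxx mul1r big1 ?addr0 // => j /negPf ->.
by rewrite mul0r.
Qed.

Lemma dot_add_vertex A i j : dot (add_vertex A i) j = dot A j + M i j.
Proof. exact: sum_add_vertex. Qed.

(* [adj_deg A] is twice [p_a(A) - 1]. *)
Definition adj_deg (A : 'I_n -> int) : int :=
  inter e b A A + \sum_(i < n) A i * ((b i)%:Z - 2).

Lemma eq_adj_deg (A B : 'I_n -> int) : A =1 B -> adj_deg A = adj_deg B.
Proof.
move=> AB; rewrite /adj_deg !interE; congr (_ + _); apply: eq_bigr => i _.
  by rewrite AB (eq_dot AB).
by rewrite AB.
Qed.

(** Adjunction: [p_a (A + E_i) = p_a A + A . E_i - 1], because [p_a E_i = 0]. *)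
Lemma adj_deg_add_vertex A i :
  adj_deg (add_vertex A i) = adj_deg A + (2 * dot A i - 2).
Proof.
have inter_add : inter e b (add_vertex A i) (add_vertex A i)
    = inter e b A A + 2 * dot A i - (b i)%:Z.
  rewrite !interE sum_add_vertex dot_add_vertex.
  have -> : M i i = - (b i)%:Z by rewrite /inter_mx eqxx.
  rewrite (eq_bigr (fun j => A j * dot A j + A j * M j i)); last first.
    by move=> j _; rewrite dot_add_vertex mulrDr (inter_mx_sym i).
  by rewrite big_split /= -/(dot A i); ring.
by rewrite /adj_deg inter_add sum_add_vertex; ring.
Qed.

(** * Computation sequences and positivity of the fundamental cycle *)

Section FundamentalCycle.

Variable Z : 'I_n -> int.
Hypothesis Z_fund : fundamental_cycle e b Z.

Lemma fundamental_dot_le0 i : dot Z i <= 0.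
Proof. by case: Z_fund => _ + _ => /(_ i); rewrite inter_delta. Qed.

(** If [A i = Z i], then [A <= Z] at the neighbours gives [A . E_i <= Z . E_i <= 0]. *)
Lemma add_vertex_le (A : 'I_n -> int) i :
  (forall j, A j <= Z j) -> 0 < dot A i -> forall j, add_vertex A i j <= Z j.
Proof.
move=> AZ dA j; rewrite /add_vertex; have [->|_] := eqVneq j i; last first.
  by rewrite addr0 AZ.
have := AZ i; rewrite le_eqVlt => /orP[/eqP Ai|]; last by rewrite /=; lia.
have := fundamental_dot_le0 i; rewrite dotE -Ai.
suff : \sum_(j < n | e i j) A j <= \sum_(j < n | e i j) Z j.
  by move: dA; rewrite dotE; lia.
by apply: ler_sum => k _.
Qed.

(* Laufer's computation sequence: as long as [A < Z] is not anti-nef, some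
   [E_i] with [A . E_i > 0] can be added without leaving [Z]. *)
Lemma adj_deg_le (A : 'I_n -> int) :
  (exists i, 0 < A i) -> (forall j, A j <= Z j) -> adj_deg A <= adj_deg Z.
Proof.
(* Induction on the total gap between [A] and [Z]. *)
move: {2}(absz _) (erefl (absz (\sum_(j < n) (Z j - A j)))) => k.
elim: k A => [|k IHk] A kE A_gt0 AZ;
  have diff_ge0 : 0 <= \sum_(j < n) (Z j - A j) by
    apply: sumr_ge0 => j _; rewrite subr_ge0.
- have /eqP : \sum_(j < n) (Z j - A j) = 0 by lia.
  rewrite psumr_eq0; last by move=> j _; rewrite subr_ge0.
  move/allP => ZA; rewrite (@eq_adj_deg A Z) // => j.
  by apply/eqP; rewrite eq_sym -subr_eq0; apply: ZA; rewrite mem_index_enum.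
- have [/existsP[i dAi]|] := boolP [exists i, 0 < dot A i].
    apply: (@le_trans _ _ (adj_deg (add_vertex A i))).
      by rewrite adj_deg_add_vertex; lia.
    apply: IHk (add_vertex_le AZ dAi).
      suff : \sum_(j < n) (Z j - A j) = \sum_(j < n) (Z j - add_vertex A i j) + 1 by lia.
      rewrite !big_split /= !sumrN.
      suff -> : \sum_(j < n) add_vertex A i j = \sum_(j < n) A j + 1 by ring.
      have := sum_add_vertex A (fun=> 1) i => /=.
      by rewrite -!mulr_suml !mulr1.
    by have [l Al] := A_gt0; exists l; rewrite /add_vertex; lia.
  rewrite negb_exists => /forallP A_antinef.
  case: Z_fund => _ _ Z_min.
  rewrite (@eq_adj_deg A Z) // => j; apply/eqP; rewrite eq_le AZ /=.
  apply: Z_min.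
    by have [l Al] := A_gt0; exists l; rewrite gt_eqF.
  by move=> i; rewrite inter_delta leNgt.
Qed.

Lemma fundamental_ge0 : neg_definite e b -> forall i, 0 <= Z i.
Proof.
move=> nd i; rewrite leNgt; apply/negP => Zi.
pose N j := if Z j < 0 then - Z j else 0.
have /(nd (fun j => (N j)%:~R)) : exists j, ((N j)%:~R : rat) != 0.
  by exists i; rewrite intr_eq0 /N Zi; lia.
rewrite inter_intr ltrz0 => NN.
have ZN : inter e b Z N <= 0.
  rewrite interE; apply: sumr_le0 => j _; apply: mulr_ge0_le0.
    by rewrite /N; case: ifP => //; lia.
  exact: fundamental_dot_le0.
(* [N + Z] is the positive part of [Z]; its support is disjoint from that of [N], so only
   nonnegative off-diagonal terms survive. *)
have : 0 <= inter e b N N + inter e b Z N.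
  rewrite /inter -big_split; apply: sumr_ge0 => j _ /=.
  rewrite -big_split; apply: sumr_ge0 => k _ /=.
  rewrite -!mulrDl intz /inter_mx; have [->|_] := eqVneq j k.
    by rewrite /N; case: ifP => Zk; rewrite ?addNr ?mulr0 ?mul0r.
  by rewrite /N; case: (e j k); case: ifP; case: ifP; nia.
lia.
Qed.

(** Where [Z] vanishes, [Z . E_i <= 0] is a sum of nonnegative neighbouring coefficients, so zeros
    spread along edges. *)
Lemma fundamental_gt0 :
  neg_definite e b -> (forall i j, connect e i j) -> forall i, 0 < Z i.
Proof.
move=> nd e_conn i; have Z_ge0 := fundamental_ge0 nd.
rewrite lt_neqAle Z_ge0 andbT eq_sym; apply/eqP => Zi0.
have Z0_closed : closed e [pred j | Z j == 0].
  apply: intro_closed => [|j k ejk /eqP Zj0]; first exact: sym_connect_sym.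
  have := fundamental_dot_le0 j; rewrite dotE Zj0 mul0r subr0 (bigD1 k) //=.
  rewrite inE eq_le Z_ge0 andbT; apply: le_trans.
  by rewrite lerDl; apply: sumr_ge0.
case: Z_fund => -[j /negP Zj] _ _; apply: Zj.
have := closed_connect Z0_closed (e_conn i j).
by rewrite !inE Zi0 eqxx.
Qed.

End FundamentalCycle.

(** * Computation sequences between the reduced cycle and [Z] *)

Section RationalGraph.

Variable Z : 'I_n -> int.
Hypothesis Z_fund : fundamental_cycle e b Z.
Hypothesis Z_gt0 : forall i, 0 < Z i.
Hypothesis adj_degZ : adj_deg Z = -2.
Hypothesis adj_deg1 : adj_deg (fun=> 1) = -2.

Implicit Types S P : {set 'I_n}.

Definition thick S : 'I_n -> int := fun j => 1 + (j \in S)%:Z.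

(** Invariants of a computation sequence at [thick S]: it is below [Z] and has [p_a = 0]. *)
Definition admissible S := (forall j, thick S j <= Z j) /\ adj_deg (thick S) = -2.

Definition nbrs S u : nat := #|[set j in S | e u j]|.

Lemma dot_thick S u :
  u \notin S -> dot (thick S) u = (valency e u + nbrs S u)%:Z - (b u)%:Z.
Proof.
move=> uS; rewrite dotE {2}/thick (negPf uS) addr0 mul1r; congr (_ - _).
rewrite big_split /= PoszD; congr (_ + _).
  by rewrite sumr_const /valency cardsE -[RHS]intz.
rewrite /nbrs -sum1_card (big_morph Posz PoszD (erefl _)) big_mkcond [RHS]big_mkcond.
by apply: eq_bigr => j _; rewrite inE; case: (j \in S); case: (e u j).
Qed.

Lemma admissible0 : admissible set0.
Proof.
have thick0 : thick set0 =1 (fun=> 1) by move=> j; rewrite /thick inE addr0.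
split=> [j|]; last by rewrite (eq_adj_deg thick0).
by rewrite thick0; have := Z_gt0 j; lia.
Qed.

(** The step has [thick S . E_u >= 1], and a value above 1 would push the genus past [p_a Z = 0]. *)
Lemma admissibleU1 S u :
    admissible S -> u \notin S -> (b u < valency e u + nbrs S u)%N ->
  admissible (u |: S) /\ (valency e u + nbrs S u = (b u).+1)%N.
Proof.
move=> [SZ chiS] uS lt_bu.
have dot_gt0 : 0 < dot (thick S) u by rewrite dot_thick //; lia.
have thickU : thick (u |: S) =1 add_vertex (thick S) u.
  move=> j; rewrite /thick /add_vertex !inE; have [->|_] := eqVneq j u.
    by rewrite (negPf uS).
  by rewrite addr0.
have leZ := add_vertex_le Z_fund SZ dot_gt0.
have : adj_deg (add_vertex (thick S) u) <= adj_deg Z.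
  apply: (adj_deg_le Z_fund) => //; exists u.
  by rewrite /add_vertex /thick eqxx (negPf uS).
rewrite adj_deg_add_vertex chiS adj_degZ => dot_le1.
have dot1 : dot (thick S) u = 1 by lia.
split; last by move: dot1; rewrite dot_thick //; lia.
split=> [j|]; first by rewrite thickU.
by rewrite (eq_adj_deg thickU) adj_deg_add_vertex chiS dot1.
Qed.

Lemma valency_nbrs_le S u :
  admissible S -> u \notin S -> (valency e u + nbrs S u <= (b u).+1)%N.
Proof.
move=> admS uS; rewrite leqNgt; apply/negP => lt_bu.
by have [] := admissibleU1 admS uS; lia.
Qed.

Lemma valency_nbrs_ge2 S u :
  admissible S -> u \notin S -> (b u < valency e u + nbrs S u)%N -> 2 <= Z u.
Proof.
move=> admS uS lt_bu; have [[/(_ u) + _] _] := admissibleU1 admS uS lt_bu.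
by rewrite /thick !inE eqxx.
Qed.

Lemma valency_le u : (valency e u <= (b u).+1)%N.
Proof. by have := @valency_nbrs_le set0 u admissible0; rewrite inE; lia. Qed.

Lemma saturated_set P :
  exists S, [/\ S \subset P, admissible S
    & forall y, y \in P -> y \notin S -> (valency e y + nbrs S y <= b y)%N].
Proof.
suff H k S : (#|P :\: S| <= k)%N -> S \subset P -> admissible S ->
  exists S', [/\ S' \subset P, admissible S'
    & forall y, y \in P -> y \notin S' -> (valency e y + nbrs S' y <= b y)%N].
  exact: (H #|P :\: set0| set0 (leqnn _) (sub0set _) admissible0).
elim: k S => [|k IHk] S cardS SP admS.
  exists S; split=> // y yP yS.
  have : y \in P :\: S by rewrite inE yS.
  by rewrite (cards0_eq (_ : #|P :\: S| = 0)%N) ?inE //; lia.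
have [/existsP[y /and3P[yP yS lt_by]]|] :=
  boolP [exists y, [&& y \in P, y \notin S & (b y < valency e y + nbrs S y)%N]].
  have [admU _] := admissibleU1 admS yS lt_by.
  apply: (IHk (y |: S)) => //; last by rewrite subUset sub1set yP.
  by move: cardS; rewrite (cardsD1 y) inE yS yP setDDl setUC.
rewrite negb_exists => /forallP noy; exists S; split=> // y yP yS.
by have := noy y; rewrite yP yS /= -leqNgt.
Qed.

Lemma nbrs_gt0 S u j : j \in S -> e u j -> (0 < nbrs S u)%N.
Proof. by move=> jS euj; apply/card_gt0P; exists j; rewrite inE jS. Qed.

Lemma nbrs_le_valency S u : (nbrs S u <= valency e u)%N.
Proof. by apply: subset_leq_card; apply/subsetP => j; rewrite !inE => /andP[]. Qed.

(** * Bad vertices and their components *)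

Hypothesis b_ge2 : forall i, (2 <= b i)%N.

Definition inner2 : {set 'I_n} := [set i | (b i == 2) && (2 <= valency e i)]%N.

Definition bad : {set 'I_n} := [set i | (b i == 2) && (3 <= valency e i)]%N.

Definition e2 : rel 'I_n := [rel i j | [&& i \in inner2, j \in inner2 & e i j]].

Lemma bad_inner2 v : v \in bad -> v \in inner2.
Proof. by rewrite !inE => /andP[-> /ltnW]. Qed.

Lemma e2_connect_sym : connect_sym e2.
Proof. by apply: sym_connect_sym => i j; rewrite /e2 /= andbCA e_sym. Qed.

(** A vertex of [inner2] with a neighbour in [S] has [val + nbrs >= 3 > b], so saturation puts it in
    [S]. *)
Lemma saturated_closed S :
    (forall y, y \in inner2 -> y \notin S -> (valency e y + nbrs S y <= b y)%N) ->
  closed e2 [in S].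
Proof.
move=> satS; apply: (intro_closed e2_connect_sym) => x y /and3P[_ yH exy] xS.
apply/negPn/negP => yS; have := satS y yH yS.
have := @nbrs_gt0 S y x xS; rewrite e_sym => /(_ exy).
by move: yH; rewrite inE => /andP[/eqP -> ]; lia.
Qed.

(* Saturating inside [inner2 :\ w] fills the component of [v] up to a neighbour
   of [w], where the computation sequence would then jump by two. *)
Lemma bad_separated v w : v \in bad -> w \in bad -> connect e2 v w -> v = w.
Proof.
move=> vB wB cvw; apply/eqP/negPn/negP => neq_vw.
have [S [SP admS satS]] := saturated_set (inner2 :\ w).
have wS : w \notin S.
  by apply/negP => /(subsetP SP); rewrite !inE eqxx.
have vS : v \in S.
  apply/negPn/negP => vS; have := satS v.
  rewrite in_setD1 neq_vw bad_inner2 // => /(_ isT vS).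
  by move: vB; rewrite inE => /andP[/eqP -> ]; lia.
have nbrs_w : nbrs S w = 0%N.
  have := valency_nbrs_le admS wS.
  by move: wB; rewrite inE => /andP[/eqP -> ]; lia.
(* Growth of [S] could only stop at [w], but by [nbrs_w] no vertex of [S] touches [w]. *)
have S_closed : closed e2 [in S].
  apply: (intro_closed e2_connect_sym) => x y /and3P[_ yH exy] xS.
  apply/negPn/negP => yS.
  have : (0 < nbrs S y)%N by apply: nbrs_gt0 xS _; rewrite e_sym.
  have [->|neq_yw] := eqVneq y w; first by rewrite nbrs_w.
  have := satS y; rewrite in_setD1 neq_yw yH => /(_ isT yS).
  by move: yH; rewrite inE => /andP[/eqP -> ]; lia.
by have := closed_connect S_closed cvw; rewrite vS (negPf wS).
Qed.

(** Otherwise the component, enlarged by the leaves with [b = 2] attached to it (which [inner2]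
    omits), is closed under adjacency, hence is the whole graph. *)
Lemma bad_component_boundary v :
    (forall i j, connect e i j) -> (exists i, 3 <= b i)%N -> v \in bad ->
  exists p : 'I_n * 'I_n, [/\ (3 <= b p.1)%N, e p.1 p.2 & connect e2 v p.2].
Proof.
move=> e_conn [u bu] vB.
pose C := [pred x | connect e2 v x].
pose X := [pred x | C x || [&& b x == 2, valency e x <= 1
                              & [exists j, e x j && C j]]%N].
have [/existsP[[i j] /and3P[]]|] := boolP [exists p : 'I_n * 'I_n,
    [&& (3 <= b p.1)%N, e p.1 p.2 & connect e2 v p.2]].
  by exists (i, j).
rewrite negb_exists => /forallP noP; exfalso.
have C2 x : C x -> x \in inner2.
  have cl : closed e2 [in inner2].
    by move=> i j /and3P[iH jH _]; rewrite !inE in iH jH *; rewrite iH jH.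
  move=> /(closed_connect cl); rewrite !inE => <-.
  by have := bad_inner2 vB; rewrite inE.
have X2 x : X x -> b x = 2%N.
  by case/orP => [/C2|/and3P[/eqP]] //; rewrite inE => /andP[/eqP].
have X_closed : closed e X.
  apply: intro_closed => [|x y exy]; first exact: sym_connect_sym.
  rewrite !inE => /orP[Cx|/and3P[_ val_x /existsP[j /andP[exj Cj]]]].
    have b_y : b y == 2%N.
      have := noP (y, x); rewrite /= e_sym exy (Cx : connect e2 v x) !andbT.
      by have := b_ge2 y; lia.
    have [val_y|val_y] := leqP (valency e y) 1.
      rewrite b_y andTb; apply/orP; right; apply/existsP; exists x.
      by rewrite e_sym exy.
    apply/orP; left; apply: (connect_trans (Cx : connect e2 v x)); apply: connect1.
    by rewrite /e2 /= C2 // exy inE b_y val_y.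
  suff -> : y = j by apply/orP; left.
  by apply: (card_le1_eqP val_x); rewrite inE.
have := closed_connect X_closed (e_conn v u).
have -> : v \in X by rewrite inE /= connect0.
by move=> /esym /X2; lia.
Qed.

(** * Paying for the complexity *)

Lemma complexity_le :
    (forall i j, connect e i j) -> (exists i, 3 <= b i)%N ->
  (complexity e)%:Z <= \sum_(i < n) Z i * ((b i)%:Z - 2).
Proof.
move=> e_conn b3.
have [S [SP admS satS]] := saturated_set inner2.
have S_closed := saturated_closed satS.
have bad_S v : v \in bad -> v \in S.
  move=> vB; apply/negPn/negP => vS; have := satS v (bad_inner2 vB) vS.
  by move: vB; rewrite inE => /andP[/eqP -> ]; lia.
(* Each bad vertex is charged to an edge from a vertex with [b >= 3] into its own component, so
   distinct bad vertices get distinct edges. *)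
pose Q := [set p : 'I_n * 'I_n | [&& (3 <= b p.1)%N, p.2 \in S & e p.1 p.2]].
have card_bad : (#|bad| <= \sum_(u < n | 3 <= b u) nbrs S u)%N.
  have -> : (\sum_(u < n | 3 <= b u) nbrs S u = #|Q|)%N.
    rewrite -sum1_card (eq_bigl (fun p : 'I_n * 'I_n =>
      (3 <= b p.1)%N && ((p.2 \in S) && e p.1 p.2))); last by move=> p; rewrite inE.
    rewrite -(pair_big_dep (fun u => 3 <= b u)%N (fun u j => (j \in S) && e u j)
                (fun _ _ => 1%N)) /=.
    apply: eq_bigr => u _; rewrite /nbrs -sum1_card.
    by apply: eq_bigl => j; rewrite inE.
  have [f fP] : exists f : 'I_n -> 'I_n * 'I_n, forall v, v \in bad ->
      [/\ (3 <= b (f v).1)%N, e (f v).1 (f v).2 & connect e2 v (f v).2].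
    have /fin_all_exists[f fP] : forall v, exists p : 'I_n * 'I_n, v \in bad ->
        [/\ (3 <= b p.1)%N, e p.1 p.2 & connect e2 v p.2].
      move=> v; have [vB|_] := boolP (v \in bad); last by exists (v, v).
      by have [p pP] := bad_component_boundary e_conn b3 vB; exists p.
    by exists f.
  have f_inj : {in bad &, injective f}.
    move=> v w vB wB fvw; have [_ _ cv] := fP v vB; have [_ _ cw] := fP w wB.
    apply: bad_separated => //; apply: connect_trans cv _.
    by rewrite fvw e2_connect_sym.
  rewrite -(card_in_imset f_inj); apply: subset_leq_card.
  apply/subsetP => _ /imsetP[v vB ->]; have [b3v ev cv] := fP v vB.
  rewrite inE b3v ev andbT /=.
  by have := closed_connect S_closed cv; rewrite bad_S.
have complexity_split :
    (complexity e <= \sum_(u < n | 3 <= b u) (valency e u - 2) + #|bad|)%N.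
  rewrite /complexity -sum1_card big_mkcond [X in (_ <= X + _)%N]big_mkcond.
  rewrite [X in (_ <= _ + X)%N]big_mkcond -big_split /=.
  apply: leq_sum => u _; rewrite inE.
  have := b_ge2 u; have := valency_le u.
  (* When [b u = 2], [valency_le] gives valency at most 3, so a bad vertex contributes exactly 1. *)
  by case: ifP; case: ifP; case: ifP; lia.
apply: (@le_trans _ _ (\sum_(u < n | 3 <= b u) (valency e u - 2 + nbrs S u))%N%:Z).
  by rewrite lez_nat (leq_trans complexity_split) // big_split leq_add2l.
rewrite (big_morph Posz PoszD (erefl _)) big_mkcond.
apply: ler_sum => u _; have Zu := Z_gt0 u; case: ifP => bu; last first.
  by have := b_ge2 u; nia.
have uS : u \notin S.
  by apply/negP => /(subsetP SP); rewrite inE; lia.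
have val_nbrs := valency_nbrs_le admS uS.
have Zu2 := valency_nbrs_ge2 admS uS.
(* With [t = nbrs S u]: if [val + t = b + 1], then [val - 2 + t = b - 1 <= 2 (b - 2)]. If
   [val <= 1], the subtraction truncates to 0 and [t <= val <= b - 2] is needed. *)
have := nbrs_le_valency S u.
case: (ltnP (b u) (valency e u + nbrs S u)) => [/Zu2|]; nia.
Qed.

End RationalGraph.

End IntersectionForm.

(** * The genus of the reduced cycle, and the conclusion *)

Lemma tree_adj_deg1 (n : nat) (e : rel 'I_n) (b : 'I_n -> nat) :
  is_tree e -> (adj_deg e b (fun=> 1) = -2)%R.
Proof.
case=> n_gt0 e_sym e_irr _ card_e.
have sum_val : (\sum_(i < n) valency e i = 2 * n.-1)%N.
  rewrite -card_e -sum1_card (eq_bigl (fun p : 'I_n * 'I_n =>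
    true && e p.1 p.2)); last by move=> p; rewrite inE.
  rewrite -(pair_big_dep (fun=> true) (fun u j => e u j) (fun _ _ => 1%N)) /=.
  apply: eq_bigr => u _; rewrite /valency -sum1_card.
  by apply: eq_bigl => j; rewrite inE.
rewrite /adj_deg interE -big_split /=.
(* [D . E_i = val_i - b_i], so the [b_i] cancel and the total is [2 (n - 1) - 2 n]. *)
rewrite (eq_bigr (fun i => (valency e i)%:Z - 2)%R); last first.
  move=> i _; rewrite !mul1r (dotE b e_sym e_irr) mul1r sumr_const /valency cardsE.
  by rewrite -[X in _ = (X - 2)%R]intz; ring.
rewrite big_split /= -(big_morph Posz PoszD (erefl _)) sum_val sumr_const card_ord.
by rewrite -mulr_natr; lia.
Qed.

Theorem theorem3 (n : nat) (e : rel 'I_n) (b : 'I_n -> nat) (Z : 'I_n -> int) :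
  rational_graph e b Z ->
  (3 <= - inter e b Z Z)%R ->
  ((complexity e)%:Z <= - inter e b Z Z - 2)%R.
Proof.
case=> tree b_ge2 nd Z_fund genus0 deg_ge3.
have [_ e_sym e_irr e_conn _] := tree.
have adj_degZ : adj_deg e b Z = (-2)%R.
  apply/eqP; rewrite -(eqr_int rat); apply/eqP; move: genus0.
  by rewrite /arith_genus -/(adj_deg e b Z) => genus0; lra.
have -> : (- inter e b Z Z - 2 = \sum_(i < n) Z i * ((b i)%:Z - 2))%R.
  by move: adj_degZ; rewrite /adj_deg; lia.
have Z_gt0 := fundamental_gt0 e_sym e_irr Z_fund nd e_conn.
apply: (complexity_le e_sym e_irr Z_fund) => //; first exact: tree_adj_deg1.
have [/existsP //|] := boolP [exists i, 3 <= b i].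
rewrite negb_exists => /forallP b_lt3.
(* If every [b i] were 2, the degree would be 2. *)
suff sum0 : (\sum_(i < n) Z i * ((b i)%:Z - 2) = 0)%R.
  by move: adj_degZ; rewrite /adj_deg; lia.
apply: big1 => i _; suff -> : b i = 2 by rewrite subrr mulr0.
by have := b_lt3 i; have := b_ge2 i; lia.
Qed.
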